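(* For $\kappa>0$ and $\alpha>0$ define $$h_{\kappa}(\alpha):=\int_0^{\kappa\alpha}\frac{y^{\alpha-1}e^{-y}}{\Gamma(\alpha)}\,dy.$$ Then, for every $\kappa>1$, the minimum of $h_\kappa$ over $(0,\infty)$ exists (is attained) and satisfies $$\min_{\alpha>0}h_{\kappa}(\alpha)>\frac{1}{2}.$$
   Context: $\Gamma$ denotes the Euler Gamma function. Equivalently, $h_\kappa(\alpha)=P\{X_{\alpha,\beta}\le \kappa E[X_{\alpha,\beta}]\}$ (for any scale $\beta>0$; the value does not depend on $\beta$), where $X_{\alpha,\beta}$ is a Gamma random variable with shape parameter $\alpha$ and scale parameter $\beta$, i.e. with density $x^{\alpha-1}e^{-x/\beta}/(\Gamma(\alpha)\beta^{\alpha})$ for $x>0$. *)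

(* Defs.v *)
From mathcomp Require Import all_boot all_order all_algebra.
From mathcomp Require Import all_classical all_reals all_analysis.
Set Implicit Arguments.
Unset Strict Implicit.
Unset Printing Implicit Defensive.
Import Order.TTheory GRing.Theory Num.Theory.
Import numFieldNormedType.Exports.

Local Open Scope classical_set_scope.
Local Open Scope ring_scope.

(* Euler's integral; it is finite, hence meaningful, for 0 < a only (Rintegral
   returns 0 when the extended-real integral is infinite). *)
Definition Gamma (R : realType) (a : R) : R :=
  \int[@lebesgue_measure R]_(y in `]0, +oo[) (y `^ (a - 1) * expR (- y)).

Definition h (R : realType) (kappa a : R) : R :=
  \int[@lebesgue_measure R]_(y in `]0, kappa * a[)
    (y `^ (a - 1) * expR (- y) / Gamma a).

(* Main.v *)
(** Write N(x) for the integral of y^(a-1) e^(-y) over ]0, x] and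
    w(y) = y^a e^(-y), so that N'(y) = w(y)/y and w'(y) = (a - y) N'(y).

    Value above 1/2: for 0 < t < a, the function
    2 N(a) - N(a-t) - N(a+t) - (w(a+t) - w(a-t))/t of t has derivative
    (w(a+t) - w(a-t))/t^2 >= 0 and tends to 0 at 0+, while the mass beyond a+t
    is at most w(a+t)/t.  Adding up, Gamma(a) <= 2 N(a) + w(a-t)/t, and t -> a
    gives Gamma(a) <= 2 N(a): the median is at most the mean a, and kappa a > a.

    Attainment: h is continuous and < 1, and tends to 1 both at 0 (because
    N(x) >= w(x)/a and Gamma(a) <= 1/a for a <= 1) and at infinity (because the
    mass beyond kappa a is exponentially small with respect to that of
    [a, kappa a]). *)
Require Import Defs.
From mathcomp Require Import all_boot all_order all_algebra.
From mathcomp Require Import all_classical all_reals all_analysis.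
From mathcomp Require Import measurable_realfun ring lra.
Import Order.TTheory GRing.Theory Num.Theory.
Import numFieldNormedType.Exports.
Local Open Scope classical_set_scope.
Local Open Scope ring_scope.

Set Implicit Arguments.
Unset Strict Implicit.

(** * Monotonicity from derivatives, and the kernel y^p e^(-y) *)

Section real_functions.
Context {R : realType}.
Implicit Types (f df G : R -> R) (a b x y p : R).

Lemma is_derive_continuous f (l : R) x : is_derive x 1 f l -> {for x, continuous f}.
Proof.
by move=> fx; apply/differentiable_continuous/derivable1_diffP; apply: ex_derive.
Qed.

Lemma is_derive_mean_value f df a b : a < b ->
  (forall x, a <= x <= b -> is_derive x 1 f (df x)) ->
  exists2 c, a < c < b & f b - f a = df c * (b - a).
Proof.
move=> ab fd; have [||c] := @MVT R f df a b ab.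
- by move=> x; rewrite in_itv/= => /andP[ax xb]; apply: fd; rewrite !ltW.
- apply: continuous_in_subspaceT => x /set_mem/=; rewrite in_itv/= => axb.
  exact: (is_derive_continuous (fd _ axb)).
by rewrite in_itv/= => acb fE; exists c.
Qed.

Lemma is_derive_ge0_le f df a b : a <= b ->
  (forall x, a <= x <= b -> is_derive x 1 f (df x)) ->
  (forall x, a < x < b -> 0 <= df x) -> f a <= f b.
Proof.
rewrite le_eqVlt => /predU1P[->//|ab] fd d0.
have [c acb fE] := is_derive_mean_value ab fd.
by rewrite -subr_ge0 fE mulr_ge0 ?d0// subr_ge0 ltW.
Qed.

(** After factoring out y^a, the bound [1 + x <= expR x] is applied at [- (a * ln y)] and
    [(1 - a) * ln y] with weights [1 - a] and [a], for which the linear terms cancel. *)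
Lemma powR_le_tangent1 a y : 0 <= a <= 1 -> 0 < y -> y `^ a <= 1 - a + a * y.
Proof.
move=> /andP[a0 a1] y0; rewrite /powR gt_eqF//.
have -> : 1 - a + a * y = expR (a * ln y) *
    ((1 - a) * expR (- (a * ln y)) + a * expR ((1 - a) * ln y)).
  rewrite (_ : (1 - a) * ln y = ln y - a * ln y); last by ring.
  rewrite expRB lnK// expRN; field.
  by rewrite gt_eqF ?expR_gt0.
rewrite ler_peMr ?expR_ge0//.
have /(ler_wpM2l (_ : 0 <= 1 - a)) H1 := expR_ge1Dx (- (a * ln y)).
have /(ler_wpM2l a0) H2 := expR_ge1Dx ((1 - a) * ln y).
have /H1 {}H1 : 0 <= 1 - a by lra.
by apply: le_trans (lerD H1 H2); nra.
Qed.

(** With [p = a - 1] this is N', the integrand of [Gamma a]; with [p = a] it is the function w of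
    the overview. *)
Definition gamma_kernel p y : R := y `^ p * expR (- y).

Lemma gamma_kernel_gt0 p y : 0 < y -> 0 < gamma_kernel p y.
Proof. by move=> y0; rewrite mulr_gt0 ?powR_gt0 ?expR_gt0. Qed.

Lemma gamma_kernel_ge0 p y : 0 <= gamma_kernel p y.
Proof. by rewrite mulr_ge0 ?powR_ge0 ?expR_ge0. Qed.

Lemma gamma_kernelE p y : 0 < y -> gamma_kernel p y = expR (p * ln y - y).
Proof. by move=> y0; rewrite /gamma_kernel /powR gt_eqF// -expRD. Qed.

Lemma gamma_kernelB1 p y : 0 < y -> gamma_kernel p y = y * gamma_kernel (p - 1) y.
Proof.
move=> y0; rewrite !gamma_kernelE// -[X in _ = X * _](lnK (_ : y \in Num.pos))//.
by rewrite -expRD; congr expR; ring.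
Qed.

Lemma is_derive_expRN y : is_derive y 1 (fun x => expR (- x)) (- expR (- y)).
Proof.
have := is_derive1_comp (is_derive_expR (- y)) (is_deriveNid y 1).
by rewrite mulrN1.
Qed.

Lemma is_derive_gamma_kernel p y : 0 < y ->
  is_derive y 1 (gamma_kernel p) ((p - y) * gamma_kernel (p - 1) y).
Proof.
move=> y0.
have := is_deriveM (is_derive1_powR p y0) (is_derive_expRN y).
move=> /is_derive_eq; apply; rewrite mulrBl -gamma_kernelB1// /gamma_kernel.
by rewrite /GRing.scale/=; ring.
Qed.

Lemma continuous_gamma_kernel p y : 0 < y -> {for y, continuous (gamma_kernel p)}.
Proof. by move=> y0; exact: (is_derive_continuous (is_derive_gamma_kernel p y0)). Qed.

End real_functions.

(** * Bounding integrals over the open half-line *)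

Section half_line_integrals.
Context {R : realType}.
Local Notation mu := (@lebesgue_measure R).
Implicit Types (f g G : R -> R) (M : R).

Lemma measurable_fun_pos_continuous f :
  (forall y, 0 < y -> {for y, continuous f}) -> measurable_fun (`]0, +oo[ : set R) f.
Proof.
move=> cf; apply: open_continuous_measurable_fun => //.
by move=> y /set_mem/=; rewrite in_itv/= andbT; exact: cf.
Qed.

(** Monotone convergence along the intervals [1/(n+1), n+1], which exhaust the half-line while
    staying away from a possible singularity at 0. *)
Lemma integral_pos_le f M : measurable_fun (`]0, +oo[ : set R) f ->
  (forall y, 0 < y -> 0 <= f y) ->
  (forall T : R, 1 <= T -> (\int[mu]_(y in `[T^-1%R, T]) (f y)%:E <= M%:E)%E) ->
  (\int[mu]_(y in `]0%R, +oo[) (f y)%:E <= M%:E)%E.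
Proof.
move=> mf f0 fM.
pose F n : set R := `[(n.+1%:R)^-1, n.+1%:R]%classic.
have F_pos n : F n `<=` `]0, +oo[%classic.
  move=> y; rewrite /F/= !in_itv/= andbT => /andP[ny _].
  by rewrite (lt_le_trans _ ny)// invr_gt0 ltr0n.
have -> : (`]0, +oo[%classic : set R) = \bigcup_n F n.
  apply/seteqP; split => [y/=|]; last by apply: bigcup_sub => n _; exact: F_pos.
  rewrite in_itv/= andbT => y0.
  pose n := Num.bound (y + y^-1); exists n => //; rewrite /F/= in_itv/=.
  have yn : y + y^-1 < n.+1%:R.
    rewrite (lt_trans (archi_boundP _)) ?ltr_nat ?ltnS//.
    by apply: addr_ge0; rewrite ?invr_ge0 ltW.
  rewrite invf_ple ?posrE ?ltr0n//.
  by apply/andP; split; apply: le_trans (ltW yn); rewrite ?lerDl ?lerDr ?invr_ge0 ltW.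
apply: (@cvge_to_le _ \oo _ _ _ _ _ (ge0_nondecreasing_set_cvg_integral _ _ _ _)).
- move=> m n mn; apply/subsetPset => y; rewrite /F/= !in_itv/= => /andP[y1 y2].
  rewrite (le_trans _ y1) ?(le_trans y2) ?ler_nat ?ltnS//.
  by rewrite lef_pV2 ?posrE ?ltr0n// ler_nat ltnS.
- by move=> n; exact: measurable_itv.
- by move=> n; apply/measurable_EFinP; exact: measurable_funS mf.
- by move=> n y /F_pos/=; rewrite in_itv/= andbT lee_fin; exact: f0.
- by apply: nearW => n; apply: fM; rewrite ler1n.
Qed.

Lemma integrable_pos f M : measurable_fun (`]0, +oo[ : set R) f ->
  (forall y, 0 < y -> 0 <= f y) ->
  (\int[mu]_(y in `]0%R, +oo[) (f y)%:E <= M%:E)%E ->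
  mu.-integrable `]0, +oo[ (EFin \o f).
Proof.
move=> mf f0 fM; apply/integrableP; split; first exact/measurable_EFinP.
under eq_integral.
  move=> y /set_mem/=; rewrite in_itv/= andbT => y0.
  rewrite ger0_norm ?f0//; over.
exact: le_lt_trans fM (ltry _).
Qed.

(** On [1/T, T] the majorant [g] integrates to G(T) - G(1/T), so a bound on the increments of [G]
    that is uniform in the endpoints passes to the half-line. *)
Lemma integral_pos_le_antiderivative f g G M :
  (forall y, 0 < y -> {for y, continuous f}) ->
  (forall y, 0 < y -> {for y, continuous g}) ->
  (forall y : R, 0 < y -> is_derive y 1 G (g y)) ->
  (forall y, 0 < y -> 0 <= f y <= g y) ->
  (forall x y, 0 < x <= y -> G y - G x <= M) ->
  (\int[mu]_(y in `]0%R, +oo[) (f y)%:E <= M%:E)%E.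
Proof.
move=> cf cg dG fg GM.
have mf := measurable_fun_pos_continuous cf.
have mg := measurable_fun_pos_continuous cg.
apply: integral_pos_le => // [y y0|T T1]; first by case/andP: (fg _ y0).
have T0 : 0 < T by exact: lt_le_trans T1.
have TV0 : 0 < T^-1 by rewrite invr_gt0.
have sub : `[T^-1, T] `<=` (`]0, +oo[ : set R).
  by move=> y /=; rewrite !in_itv/= andbT => /andP[Ty _]; exact: lt_le_trans Ty.
apply: (@le_trans _ _ (\int[mu]_(y in `[T^-1%R, T]) (g y)%:E)%E).
  apply: ge0_le_integral => //=.
  - by move=> y /sub/=; rewrite in_itv/= andbT lee_fin => /fg/andP[].
  - by apply/measurable_EFinP; exact: measurable_funS mf.
  - by apply/measurable_EFinP; exact: measurable_funS mg.
  - by move=> y /sub/=; rewrite in_itv/= andbT lee_fin => /fg/andP[].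
(* At [T = 1] the interval is a single point and falls outside the fundamental theorem; [0 <= M]
   then comes from [GM] with equal endpoints. *)
have [T1' | ] := ltP 1 T; last first.
  move=> T1'; have -> : T = 1 by apply/le_anti; rewrite T1 T1'.
  rewrite invr1 set_itv1 integral_set1 lee_fin -(subrr (G 1)) GM//.
  by rewrite ltr01 lexx.
have TVT : T^-1 < T by rewrite (lt_trans _ T1')// invf_lt1.
have cG y : 0 < y -> {for y, continuous G} by move=> /dG; exact: is_derive_continuous.
rewrite (@continuous_FTC2 _ g G)//.
- by rewrite -EFinB lee_fin GM// TV0 ltW.
- apply: continuous_in_subspaceT => y /set_mem/sub/=.
  by rewrite in_itv/= andbT => /cg.
- split.
  + move=> y; rewrite in_itv/= => /andP[Ty _].
    by have dGy := dG _ (lt_trans TV0 Ty); exact: ex_derive.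
  + by apply: cvg_at_right_filter; exact: cG.
  + by apply: cvg_at_left_filter; exact: cG.
- move=> y; rewrite in_itv/= => /andP[Ty _].
  have := dG _ (lt_trans TV0 Ty) => dGy.
  by rewrite derive1E derive_val.
Qed.

End half_line_integrals.

(** * Finiteness, derivative and monotonicity of the incomplete gamma integral *)

Section incomplete_gamma.
Context {R : realType}.
Local Notation mu := (@lebesgue_measure R).
Implicit Types (a c p x y M T : R).

Lemma measurable_gamma_kernel p :
  measurable_fun (`]0, +oo[ : set R) (gamma_kernel p).
Proof. by apply: measurable_fun_pos_continuous => y; exact: continuous_gamma_kernel. Qed.

(* The majorant of the kernel has the explicit antiderivative
   (y^a - 1 - a y) e^(-y) / a. *)
Lemma integral_gamma_kernel_le a : 0 < a <= 1 ->
  (\int[mu]_(y in `]0%R, +oo[) (gamma_kernel (a - 1) y)%:E <= a^-1%:E)%E.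
Proof.
move=> /andP[a0 a1].
pose G (y : R) := a^-1 * (gamma_kernel a y - (1 + a * y) * expR (- y)).
pose g (y : R) := gamma_kernel (a - 1) y +
  a^-1 * ((1 - a + a * y) * expR (- y) - gamma_kernel a y).
have lin_derive (b c y : R) : is_derive y 1 (fun x => b + c * x) c.
  have := is_deriveD (is_derive_cst b y 1) (is_deriveZ c (is_derive_id y 1)).
  by rewrite add0r /GRing.scale/= mulr1.
have linexp_derive (b c y : R) : is_derive y 1 (fun x => (b + c * x) * expR (- x))
    (c * expR (- y) - (b + c * y) * expR (- y)).
  have := is_deriveM (lin_derive b c y) (is_derive_expRN y).
  by move=> /is_derive_eq; apply; rewrite /GRing.scale/=; ring.
apply: (@integral_pos_le_antiderivative _ _ g G) => [y|y|y|y|x y].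
- exact: continuous_gamma_kernel.
- move=> y0; apply: continuousD; first exact: continuous_gamma_kernel.
  apply: continuousM; first exact: cst_continuous.
  apply: continuousB; last exact: continuous_gamma_kernel.
  exact: (is_derive_continuous (linexp_derive _ _ _)).
- move=> y0.
  have := is_deriveZ a^-1 (is_deriveB (is_derive_gamma_kernel a y0) (linexp_derive 1 a y)).
  move=> /is_derive_eq; apply; rewrite /g/GRing.scale/= (gamma_kernelB1 a y0).
  by field; rewrite gt_eqF.
- move=> y0; rewrite gamma_kernel_ge0/= /g lerDl mulr_ge0 ?invr_ge0 ?(ltW a0)//.
  rewrite subr_ge0 ler_pM2r ?expR_gt0// powR_le_tangent1//.
  by rewrite ltW.
(* The tangent bound gives [G y <= 0], while [- (a * G x)] is at most (1 + a x) e^(-x) <= 1, so the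
   increment is at most 1/a. *)
- move=> /andP[x0 xy]; rewrite -mulrBr -[leRHS]mulr1 ler_pM2l ?invr_gt0//.
  have y0 : 0 < y by exact: lt_le_trans xy.
  have : gamma_kernel a y <= (1 + a * y) * expR (- y).
    rewrite ler_pM2r ?expR_gt0// (le_trans (powR_le_tangent1 _ y0)) ?a1 ?(ltW a0)//.
    by rewrite lerD2r gerBl ltW.
  have := gamma_kernel_ge0 a x.
  have : (1 + a * x) * expR (- x) <= 1.
    rewrite expRN ler_pdivrMr ?expR_gt0// mul1r.
    apply: le_trans (expR_ge1Dx x); by rewrite lerD2l ler_piMl// ltW.
  lra.
Qed.

Lemma integrable_gamma_kernel a : 0 < a ->
  mu.-integrable `]0, +oo[ (EFin \o gamma_kernel (a - 1)).
Proof.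
move=> a0; have [a1|a1] := leP a 1.
  apply: (integrable_pos (M := a^-1)).
  - exact: measurable_gamma_kernel.
  - by move=> y _; exact: gamma_kernel_ge0.
  - by apply: integral_gamma_kernel_le; rewrite a0.
pose p := a - 1; have p0 : 0 < p by rewrite subr_gt0.
(* [C] is (2p)^p: multiplying [ln u < u] at u = y / (2p) by [p] gives y^p <= C e^(y/2), so the
   kernel is at most C e^(-y/2). *)
pose C := expR (p * ln (2 * p)).
have C0 : 0 < C by exact: expR_gt0.
have dexp y : is_derive y 1 (fun x => expR (- (2^-1 * x))) (- (expR (- (2^-1 * y)) / 2)).
  have D := is_deriveN (is_deriveZ 2^-1 (is_derive_id y 1)).
  have := is_derive1_comp (is_derive_expR _) D.
  by move=> /is_derive_eq; apply; rewrite /GRing.scale/= mulr1 mulrN mulrC.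
apply: (integrable_pos (M := 2 * C)).
- exact: measurable_gamma_kernel.
- by move=> y _; exact: gamma_kernel_ge0.
apply: (@integral_pos_le_antiderivative _ _ (fun y => C * expR (- (2^-1 * y)))
  (fun y => (- (2 * C)) * expR (- (2^-1 * y)))) => [y|y y0|y y0|y y0|x y /andP[x0 xy]].
- exact: continuous_gamma_kernel.
- apply: continuousM; first exact: cst_continuous.
  exact: (is_derive_continuous (dexp y)).
- have := is_deriveZ (- (2 * C)) (dexp y).
  by move=> /is_derive_eq; apply; rewrite /GRing.scale/=; field.
- rewrite gamma_kernel_ge0/= gamma_kernelE// -expRD ler_expR.
  have y2p : 0 < y / (2 * p) by rewrite divr_gt0// mulr_gt0.
  have := ln_sublinear y2p; rewrite ln_div ?posrE ?mulr_gt0// -/p.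
  move=> /ltW/(ler_wpM2l (ltW p0)).
  rewrite (_ : p * (y / _) = y / 2); first by lra.
  by field; rewrite gt_eqF.
- have ey : 0 <= C * expR (- (2^-1 * y)) by rewrite mulr_ge0 ?expR_ge0.
  have : 0 <= C * (1 - expR (- (2^-1 * x))).
    rewrite mulr_ge0 ?expR_ge0// subr_ge0 -[leRHS]expR0 ler_expR oppr_le0.
    by rewrite mulr_ge0// ltW.
  by lra.
Qed.

Definition lower_gamma a x : R := \int[mu]_(y in `]0, x]) gamma_kernel (a - 1) y.

Lemma integrable_lower_gamma a x : 0 < a ->
  mu.-integrable `]0, x] (EFin \o gamma_kernel (a - 1)).
Proof.
move=> a0; apply: integrableS (integrable_gamma_kernel a0) => //.
by move=> y /=; rewrite !in_itv/= andbT => /andP[].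
Qed.

Lemma lower_gamma_ge0 a x : 0 <= lower_gamma a x.
Proof. by apply: Rintegral_ge0 => y _; exact: gamma_kernel_ge0. Qed.

Lemma is_derive_lower_gamma a x : 0 < a -> 0 < x ->
  is_derive x 1 (lower_gamma a) (gamma_kernel (a - 1) x).
Proof.
move=> a0 x0; have xx1 : x < x + 1 by rewrite ltrDl.
have [||dF F'] := continuous_FTC1 xx1 (integrable_lower_gamma (x + 1) a0).
- exact: x0.
- exact: continuous_gamma_kernel.
- by split; [exact: dF|rewrite -derive1E; exact: F'].
Qed.

Lemma continuous_lower_gamma a x : 0 < a -> 0 < x ->
  {for x, continuous (lower_gamma a)}.
Proof. by move=> a0 x0; exact: (is_derive_continuous (is_derive_lower_gamma a0 x0)). Qed.

(** Integrability keeps the extended integral finite, so its real part loses nothing and comparisons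
    can be made between extended reals. *)
Lemma lower_gamma_fine a x : 0 < a ->
  (lower_gamma a x)%:E = (\int[mu]_(y in `]0%R, x]) (gamma_kernel (a - 1) y)%:E)%E.
Proof.
by move=> a0; rewrite fineK// integrable_fin_num//; exact: integrable_lower_gamma.
Qed.

Lemma Gamma_fine a : 0 < a ->
  (Gamma a)%:E = (\int[mu]_(y in `]0%R, +oo[) (gamma_kernel (a - 1) y)%:E)%E.
Proof.
by move=> a0; rewrite fineK// integrable_fin_num//; exact: integrable_gamma_kernel.
Qed.

Lemma lower_gamma_le_Gamma a x : 0 < a -> lower_gamma a x <= Gamma a.
Proof.
move=> a0; rewrite -lee_fin lower_gamma_fine// Gamma_fine//.
apply: ge0_subset_integral => //=.
- by apply/measurable_EFinP; exact: measurable_gamma_kernel.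
- by move=> y _; rewrite lee_fin gamma_kernel_ge0.
- by move=> y /=; rewrite !in_itv/= andbT => /andP[].
Qed.

(** The interval [1/T, T] lies in ]0, T], so bounds on the truncations pass to the whole
    integral. *)
Lemma Gamma_le a M : 0 < a -> (forall T, 1 <= T -> lower_gamma a T <= M) ->
  Gamma a <= M.
Proof.
move=> a0 NM; rewrite -lee_fin Gamma_fine//; apply: integral_pos_le.
- exact: measurable_gamma_kernel.
- by move=> y _; exact: gamma_kernel_ge0.
move=> T T1; apply: (@le_trans _ _ (lower_gamma a T)%:E); last by rewrite lee_fin NM.
rewrite lower_gamma_fine//; apply: ge0_subset_integral => //=.
- apply/measurable_EFinP; apply: measurable_funS (measurable_gamma_kernel _) => //.
  by move=> y /=; rewrite !in_itv/= andbT => /andP[].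
- by move=> y _; rewrite lee_fin gamma_kernel_ge0.
- move=> y /=; rewrite !in_itv/= => /andP[Ty ->]; rewrite andbT.
  by rewrite (lt_le_trans _ Ty)// invr_gt0 (lt_le_trans _ T1).
Qed.

Lemma lower_gamma_homo a x y : 0 < a -> 0 < x <= y ->
  lower_gamma a x <= lower_gamma a y.
Proof.
move=> a0 /andP[x0 xy].
apply: (@is_derive_ge0_le _ _ (gamma_kernel (a - 1))) => // z /andP[xz _].
  by apply: is_derive_lower_gamma => //; exact: lt_le_trans xz.
exact: gamma_kernel_ge0.
Qed.

Lemma lower_gamma_lt a x y : 0 < a -> 0 < x < y ->
  lower_gamma a x < lower_gamma a y.
Proof.
move=> a0 /andP[x0 xy].
have [z /andP[xz _] E] := is_derive_mean_value xy (fun z (xzy : x <= z <= y) =>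
  is_derive_lower_gamma a0 (lt_le_trans x0 (proj1 (andP xzy)))).
rewrite -subr_gt0 E mulr_gt0 ?subr_gt0//.
by rewrite gamma_kernel_gt0// (lt_trans x0).
Qed.

End incomplete_gamma.

(** * Tail estimates and the comparison of the median with the mean *)

Section mean_median.
Context {R : realType}.
Implicit Types (a c k x y s t : R).

(** Beyond [c] the factor (y - a)/(c - a) is at least 1, so N' <= -w'/(c - a) there, and the right
    side integrates to at most w(c)/(c - a). *)
Lemma Gamma_le_tail a c : 0 < a < c ->
  Gamma a <= lower_gamma a c + gamma_kernel a c / (c - a).
Proof.
move=> /andP[a0 ac]; have c0 : 0 < c by exact: lt_trans ac.
have ca0 : 0 < c - a by rewrite subr_gt0.
have kac0 y : 0 <= gamma_kernel a y / (c - a).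
  by rewrite divr_ge0 ?gamma_kernel_ge0// ltW.
apply: Gamma_le => // T T1; have T0 : 0 < T by exact: lt_le_trans T1.
have [Tc|cT] := leP T c.
  by rewrite (le_trans (lower_gamma_homo a0 (_ : 0 < T <= c))) ?T0// lerDl.
pose f y := - lower_gamma a y - (c - a)^-1 * gamma_kernel a y.
pose df y := - gamma_kernel (a - 1) y -
  (c - a)^-1 * ((a - y) * gamma_kernel (a - 1) y).
suff : f c <= f T by rewrite /f; have := kac0 T; lra.
apply: (@is_derive_ge0_le _ f df) => [|y /andP[cy _]|y /andP[cy _]].
- exact: ltW.
- have y0 : 0 < y by exact: lt_le_trans cy.
  exact: is_deriveB (is_deriveN (is_derive_lower_gamma a0 y0))
    (is_deriveZ _ (is_derive_gamma_kernel a y0)).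
- have -> : df y = gamma_kernel (a - 1) y * ((y - c) / (c - a)).
    by rewrite /df; field; rewrite gt_eqF.
  by rewrite mulr_ge0 ?gamma_kernel_ge0// divr_ge0 ?subr_ge0 ?ltW.
Qed.

(** The comparison used for the tail, reversed: on [a, c] the factor (y - a)/(c - a) is at most 1,
    so N' >= -w'/(c - a). The mass N(a) is discarded. *)
Lemma lower_gamma_ge_increment a c : 0 < a < c ->
  (gamma_kernel a a - gamma_kernel a c) / (c - a) <= lower_gamma a c.
Proof.
move=> /andP[a0 ac]; have ca0 : 0 < c - a by rewrite subr_gt0.
pose f y := lower_gamma a y + (c - a)^-1 * gamma_kernel a y.
pose df y := gamma_kernel (a - 1) y +
  (c - a)^-1 * ((a - y) * gamma_kernel (a - 1) y).
suff : f a <= f c by rewrite /f; have := lower_gamma_ge0 a a; lra.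
apply: (@is_derive_ge0_le _ f df) => [|y /andP[ay _]|y /andP[ay yc]].
- exact: ltW.
- have y0 : 0 < y by exact: lt_le_trans ay.
  exact: is_deriveD (is_derive_lower_gamma a0 y0)
    (is_deriveZ _ (is_derive_gamma_kernel a y0)).
- have -> : df y = gamma_kernel (a - 1) y * ((c - y) / (c - a)).
    by rewrite /df; field; rewrite gt_eqF.
  by rewrite mulr_ge0 ?gamma_kernel_ge0// divr_ge0 ?subr_ge0 ?ltW.
Qed.

(** Since w'(y) = (a - y) N'(y) <= a N'(y), the function a N - w is nondecreasing, and near 0 it is
    bounded below by -y^a, which tends to 0. *)
Lemma lower_gamma_ge_kernel a x : 0 < a -> 0 < x ->
  gamma_kernel a x / a <= lower_gamma a x.
Proof.
move=> a0 x0.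
pose f y := a * lower_gamma a y - gamma_kernel a y.
have f_homo y : 0 < y <= x -> f y <= f x.
  move=> /andP[y0 yx].
  apply: (@is_derive_ge0_le _ f (fun z => a * gamma_kernel (a - 1) z -
      ((a - z) * gamma_kernel (a - 1) z)) _ _ yx) => z /andP[yz _].
    have z0 : 0 < z by exact: lt_le_trans yz.
    exact: is_deriveB (is_deriveZ _ (is_derive_lower_gamma a0 z0))
      (is_derive_gamma_kernel a z0).
  rewrite -mulrBl opprB addrC subrK mulr_ge0 ?gamma_kernel_ge0//.
  by rewrite ltW// (lt_trans y0).
rewrite ler_pdivrMr// mulrC -subr_ge0 -oppr_le0.
apply: (cvgr_to_ge (powR_cvg0 a0)); near=> y.
have y0 : 0 < y by [].
have yx : y <= x by near: y; exact: nbhs_right_le.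
have := f_homo y; rewrite y0 yx => /(_ isT).
have : gamma_kernel a y <= y `^ a.
  by rewrite /gamma_kernel ler_piMr ?powR_ge0// -[leRHS]expR0 ler_expR oppr_le0 ltW.
have := mulr_ge0 (ltW a0) (lower_gamma_ge0 a y).
rewrite /f; lra.
Unshelve. all: by end_near. Qed.

Lemma is_derive_mirror (f : R -> R) (l : R) a t :
  is_derive (a - t) 1 f l -> is_derive t 1 (fun s => f (a - s)) (- l).
Proof.
move=> fl.
have := @is_derive1_comp _ f (fun s => a - s) _ _ _ fl (is_deriveB (is_derive_cst a t 1) (is_derive_id t 1)).
by rewrite sub0r mulrN1.
Qed.

Lemma is_derive_translate (f : R -> R) (l : R) a t :
  is_derive (a + t) 1 f l -> is_derive t 1 (fun s => f (a + s)) l.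
Proof.
move=> fl.
have := @is_derive1_comp _ f (fun s => a + s) _ _ _ fl (is_deriveD (is_derive_cst a t 1) (is_derive_id t 1)).
by rewrite add0r mulr1.
Qed.

Lemma is_derive0_cvg_at_right (f : R -> R) (l : R) :
  is_derive (0 : R) 1 f l -> f 0 = 0 -> f s / s @[s --> (0 : R)^'+] --> l.
Proof.
move=> [df <-] f0; apply: cvg_dnbhs_at_right.
rewrite (_ : (fun s => f s / s) =
  (fun s => s^-1 *: ((f \o shift 0) (s *: 1) - f 0))); first exact: df.
by apply/funext => s; rewrite f0 subr0/= addr0 /GRing.scale/= mulr1 mulrC.
Qed.

(** In logarithms, the difference of the two sides vanishes at [t = 0] and has derivative 2 s^2 /
    (a^2 - s^2) >= 0. *)
Lemma gamma_kernel_reflect_le a t : 0 < t < a ->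
  gamma_kernel a (a - t) <= gamma_kernel a (a + t).
Proof.
move=> /andP[t0 ta]; have a0 : 0 < a by exact: lt_trans ta.
pose f s := a * ln (a + s) - a * ln (a - s) - 2 * s.
have : f 0 <= f t.
  apply: (@is_derive_ge0_le _ f (fun s => a * (a + s)^-1 + a * (a - s)^-1 - 2)).
  - exact: ltW.
  - move=> s /andP[s0 st].
    have as0 : 0 < a + s by lra.
    have sa0 : 0 < a - s by lra.
    have D1 := is_derive_translate (is_derive1_ln as0).
    have D2 := is_derive_mirror (is_derive1_ln sa0).
    have := is_deriveB (is_deriveB (is_deriveZ a D1) (is_deriveZ a D2))
      (is_deriveZ 2 (is_derive_id s 1)).
    by move=> /is_derive_eq; apply; rewrite /GRing.scale/=; ring.
  - move=> s /andP[s0 st].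
    have as0 : 0 < a + s by lra.
    have sa0 : 0 < a - s by lra.
    have -> : a * (a + s)^-1 + a * (a - s)^-1 - 2 = 2 * s ^+ 2 / ((a + s) * (a - s)).
      by field; rewrite !gt_eqF.
    by rewrite divr_ge0 ?mulr_ge0 ?sqr_ge0// ltW.
rewrite /f subr0 addr0 subrr mulr0 subr0 => f0.
by rewrite !gamma_kernelE ?ler_expR; lra.
Qed.

Definition kernel_gap a t : R := gamma_kernel a (a + t) - gamma_kernel a (a - t).

(** From w'(y) = (a - y) N'(y). Divided by [t], this cancels the derivative of N(a - t) + N(a + t);
    the case [t = 0] yields the limit of the quotient gap/t at 0. *)
Lemma is_derive_kernel_gap a t : 0 <= t < a -> is_derive t 1 (kernel_gap a)
  (t * (gamma_kernel (a - 1) (a - t) - gamma_kernel (a - 1) (a + t))).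
Proof.
move=> /andP[t0 ta]; have apt : 0 < a + t by lra.
have amt : 0 < a - t by lra.
have := is_deriveB (is_derive_translate (is_derive_gamma_kernel a apt))
  (is_derive_mirror (is_derive_gamma_kernel a amt)).
by move=> /is_derive_eq; apply; ring.
Qed.

Lemma lower_gamma_reflect a t : 0 < t < a ->
  lower_gamma a (a - t) + lower_gamma a (a + t) + kernel_gap a t / t
    <= 2 * lower_gamma a a.
Proof.
move=> /andP[t0 ta]; have a0 : 0 < a by exact: lt_trans ta.
pose G s := 2 * lower_gamma a a - lower_gamma a (a - s) - lower_gamma a (a + s)
  - kernel_gap a s / s.
suff : 0 <= G t by rewrite /G; lra.
have G_homo s : 0 < s <= t -> G s <= G t.
  move=> /andP[s0 st].
  (* All values of N' cancel; only the derivative of 1/u in the last term of [G] survives. *)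
  apply: (@is_derive_ge0_le _ G (fun u => kernel_gap a u / u ^+ 2)); first exact: st.
    move=> u /andP[su ut].
    have u0 : 0 < u by lra.
    have apu : 0 < a + u by lra.
    have amu : 0 < a - u by lra.
    have u0a : 0 <= u < a by lra.
    have u0' : u != 0 by rewrite gt_eqF.
    have D1 := is_deriveM (is_derive_kernel_gap u0a) (is_deriveV u0' (is_derive_id u 1)).
    have D2 := is_derive_mirror (is_derive_lower_gamma a0 amu).
    have D3 := is_derive_translate (is_derive_lower_gamma a0 apu).
    have := is_deriveB (is_deriveB (is_deriveB (is_derive_cst (2 * lower_gamma a a) u 1)
      D2) D3) D1.
    by move=> /is_derive_eq; apply; rewrite /GRing.scale/=; field.
  move=> u /andP[su ut]; rewrite divr_ge0 ?sqr_ge0// subr_ge0.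
  by apply: gamma_kernel_reflect_le; lra.
have gap0 : kernel_gap a 0 = 0 by rewrite /kernel_gap addr0 subr0 subrr.
have cvgG : G s @[s --> 0^'+] --> (0 : R).
  rewrite [X in _ --> X](_ : (0 : R) = 2 * lower_gamma a a - lower_gamma a (a - 0)
      - lower_gamma a (a + 0) - 0); last by rewrite addr0 !subr0; ring.
  apply: cvgB; [apply: cvgB; [apply: cvgB; first exact: cvg_cst|]|].
  - apply: cvg_at_right_filter.
    have a0' : 0 < a - 0 by rewrite subr0.
    exact: (is_derive_continuous (is_derive_mirror (is_derive_lower_gamma a0 a0'))).
  - apply: cvg_at_right_filter.
    have a0' : 0 < a + 0 by rewrite addr0.
    exact: (is_derive_continuous (is_derive_translate (is_derive_lower_gamma a0 a0'))).
  (* The gap vanishes at 0, so gap/s tends to its derivative there, whose factor [t] is 0. *)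
  - rewrite [X in _ --> X](_ : (0 : R) = 0 * (gamma_kernel (a - 1) (a - 0)
        - gamma_kernel (a - 1) (a + 0))); last by rewrite mul0r.
    apply: is_derive0_cvg_at_right => //.
    by apply: is_derive_kernel_gap; rewrite lexx.
apply: (cvgr_to_le cvgG); near=> s; apply: G_homo.
by apply/andP; split => //; near: s; exact: nbhs_right_le.
Unshelve. all: by end_near. Qed.

Lemma Gamma_le_median a : 0 < a -> Gamma a <= 2 * lower_gamma a a.
Proof.
move=> a0.
(* The error term dominates w(s)/(a - s) as soon as s < a/2. *)
have cvgp : 2 * lower_gamma a a + s `^ a * (2 / a) @[s --> 0^'+] -->
    2 * lower_gamma a a + 0 * (2 / a).
  by apply: cvgD; [exact: cvg_cst|apply: cvgMr_tmp; exact: powR_cvg0].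
rewrite mul0r addr0 in cvgp.
apply: (cvgr_to_ge cvgp); near=> s.
have s0 : 0 < s by [].
have sa : s < a / 2 by near: s; apply: nbhs_right_lt; rewrite divr_gt0.
(* The reflection is taken at t = a - s, so that a - t = s tends to 0; adding the tail bound at c =
   a + t cancels w(a + t)/t. *)
have t0 : 0 < a - s < a by lra.
have := lower_gamma_reflect t0; rewrite /kernel_gap subKr.
have c0 : 0 < a < a + (a - s) by lra.
have := Gamma_le_tail c0; rewrite (_ : a + (a - s) - a = a - s); last by ring.
have := lower_gamma_ge0 a s.
have : gamma_kernel a s / (a - s) <= s `^ a * (2 / a).
  apply: ler_pM.
  - exact: gamma_kernel_ge0.
  - by rewrite invr_ge0; lra.
  - by rewrite /gamma_kernel ler_piMr ?powR_ge0// -[leRHS]expR0 ler_expR oppr_le0 ltW.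
  - by rewrite -invf_div lef_pV2 ?posrE; lra.
by lra.
Unshelve. all: by end_near. Qed.

End mean_median.

(** * The normalised function [h]: bounds and behaviour at both ends *)

Section gamma_cdf_at_multiple_of_mean.
Context {R : realType}.
Local Notation mu := (@lebesgue_measure R).
Implicit Types (a b k s x y : R).

Lemma Gamma_gt0 a : 0 < a -> 0 < Gamma a.
Proof.
move=> a0; apply: lt_le_trans (lower_gamma_le_Gamma 2 a0).
by apply: le_lt_trans (lower_gamma_ge0 a 1) (lower_gamma_lt a0 _); lra.
Qed.

Lemma hE k a : 0 < a -> h k a = lower_gamma a (k * a) / Gamma a.
Proof.
move=> a0.
have ik : mu.-integrable `]0, k * a[ (EFin \o gamma_kernel (a - 1)).
  apply: integrableS (integrable_gamma_kernel a0) => //.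
  by move=> y /=; rewrite !in_itv/= andbT => /andP[].
rewrite /h RintegralZr//; congr (_ * _).
exact: Rintegral_itv_bndo_bndc.
Qed.

Lemma h_lt1 k a : 0 < k -> 0 < a -> h k a < 1.
Proof.
move=> k0 a0; rewrite hE// ltr_pdivrMr ?Gamma_gt0// mul1r.
apply: lt_le_trans (lower_gamma_le_Gamma (k * a + 1) a0).
by apply: lower_gamma_lt => //; rewrite mulr_gt0//= ltrDl.
Qed.

Lemma h_gt_half k a : 1 < k -> 0 < a -> 1 / 2 < h k a.
Proof.
move=> k1 a0; rewrite hE// ltr_pdivlMr ?Gamma_gt0//.
have aka : 0 < a < k * a by rewrite a0/= -[ltLHS]mul1r ltr_pM2r.
have := lower_gamma_lt a0 aka; have := Gamma_le_median a0; lra.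
Qed.

(** With a = s^2, the bounds N >= w/a and Gamma(a) <= 1/a give h >= w(k a) >= 1 + a ln(k a) - k a.
    Squaring the parameter makes the loss linear: [ln s^-1 <= s^-1] turns into s^2 ln s >= -s. *)
Lemma h_ge_near0 k s : 1 < k -> 0 < s <= 1 -> 1 - (2 + k) * s <= h k (s ^+ 2).
Proof.
move=> k1 /andP[s0 s1]; have a0 : 0 < s ^+ 2 by rewrite exprn_gt0.
have k0 : 0 < k by lra.
have ka0 : 0 < k * s ^+ 2 by rewrite mulr_gt0.
apply: (@le_trans _ _ (gamma_kernel (s ^+ 2) (k * s ^+ 2))).
  rewrite gamma_kernelE//; apply: le_trans (expR_ge1Dx _).
  have ks : s ^+ 2 * ln (s ^+ 2) <= s ^+ 2 * ln (k * s ^+ 2).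
    by rewrite ler_pM2l// ler_ln ?posrE// ler_pMl// ltW.
  have sl : - s <= s ^+ 2 * ln s.
    have : ln s^-1 <= s^-1 by rewrite ltW// ln_sublinear ?invr_gt0.
    rewrite lnV ?posrE// => /(ler_wpM2l (ltW a0)); rewrite expr2 mulfK ?gt_eqF//.
    by rewrite -expr2 mulrN lerNl.
  have : s ^+ 2 * ln (s ^+ 2) = 2 * (s ^+ 2 * ln s).
    by rewrite lnXn// mulrnAr mulr_natl.
  have : k * s ^+ 2 <= k * s by rewrite ler_pM2l// expr2 ger_pMr.
  lra.
rewrite hE// ler_pdivlMr ?Gamma_gt0//.
apply: le_trans (lower_gamma_ge_kernel a0 ka0).
apply: ler_wpM2l; first exact: gamma_kernel_ge0.
rewrite -lee_fin Gamma_fine//; apply: integral_gamma_kernel_le.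
by rewrite a0/= exprn_ile1// ltW.
Qed.

(* delta is minus the logarithm of k exp(1 - k), the a-th power of which is the
   ratio of y^a e^(-y) at k a and at a. *)
Lemma h_ge_near_pinfty k a (delta := k - 1 - ln k) : 1 < k -> 0 < a ->
  0 < delta /\ 1 - (delta * a)^-1 <= h k a.
Proof.
move=> k1 a0; have k0 : 0 < k by lra.
have d0 : 0 < delta.
  have : 1 + ln k < expR (ln k) by rewrite expR_gt1Dx// gt_eqF// ln_gt0.
  by rewrite lnK// /delta; lra.
split=> //; have da0 : 0 < delta * a by rewrite mulr_gt0.
have aka : 0 < a < k * a by rewrite a0/= -[ltLHS]mul1r ltr_pM2r.
have D0 : 0 < k * a - a by rewrite subr_gt0; case/andP: aka.
have := Gamma_le_tail aka; have := lower_gamma_ge_increment aka.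
have := lower_gamma_le_Gamma (k * a) a0.
set N := lower_gamma _ _; set w := gamma_kernel a a; set wk := gamma_kernel a _.
move=> NG Nw GN.
rewrite hE// ler_pdivlMr ?Gamma_gt0// -/N mulrBl mul1r lerBlDl -lerBlDr.
rewrite mulrC ler_pdivlMr//.
apply: (@le_trans _ _ (wk / (k * a - a) * (delta * a))).
  by rewrite ler_pM2r// lerBlDl.
apply: le_trans NG; apply: le_trans Nw; rewrite mulrAC ler_pM2r ?invr_gt0//.
(* What remains is [wk * (1 + delta * a) <= w]; as [w = wk * expR (delta * a)], this is
   [1 + x <= expR x]. *)
rewrite lerBrDl -{1}[wk]mulr1 -mulrDr.
have -> : wk = w / expR (delta * a).
  rewrite /wk /w !gamma_kernelE ?(mulr_gt0 k0)// lnM ?posrE// -expRB.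
  by congr expR; rewrite /delta; ring.
rewrite mulrAC ler_pdivrMr ?expR_gt0// ler_pM2l ?gamma_kernel_gt0//.
exact: expR_ge1Dx.
Qed.

(** * Continuity in the shape parameter *)

Lemma gamma_kernel_le_endpoints a1 a2 a y : 0 < y -> a1 <= a <= a2 ->
  gamma_kernel (a - 1) y <= gamma_kernel (a1 - 1) y + gamma_kernel (a2 - 1) y.
Proof.
move=> y0 /andP[a1a aa2].
(* y^(a-1) is nonincreasing in [a] for y <= 1 and nondecreasing for y > 1, so one endpoint always
   dominates. *)
have [y1|y1] := leP y 1.
  rewrite -[leLHS]addr0 lerD ?gamma_kernel_ge0// !gamma_kernelE// ler_expR lerD2r.
  by rewrite ler_wnM2r ?ln_le0// lerD2r.
rewrite -[leLHS]add0r lerD ?gamma_kernel_ge0// !gamma_kernelE// ler_expR lerD2r.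
by rewrite ler_wpM2r ?lerD2r ?ln_ge0// ltW.
Qed.

(** Integrating the endpoint bound between [x] and [y] gives a modulus of continuity in the upper
    limit that is uniform over shapes in [a1, a2]. *)
Lemma lower_gamma_dist_le a1 a2 a x y : 0 < a1 -> a1 <= a <= a2 ->
  0 < x -> 0 < y ->
  `|lower_gamma a x - lower_gamma a y| <=
  `|(lower_gamma a1 x + lower_gamma a2 x) - (lower_gamma a1 y + lower_gamma a2 y)|.
Proof.
move=> a10 a1aa2 + +; have /andP[a1a aa2] := a1aa2.
have a0 : 0 < a by exact: lt_le_trans a1a.
have a20 : 0 < a2 by exact: lt_le_trans aa2.
wlog xy : x y / x <= y => [hw x0 y0|x0 y0].
  have [xy|/ltW yx] := leP x y; first exact: hw.
  by rewrite distrC [leRHS]distrC; exact: hw.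
rewrite distrC [leRHS]distrC !ger0_norm ?subr_ge0; last 2 first.
- by rewrite lerD// lower_gamma_homo// x0.
- by rewrite lower_gamma_homo// x0.
pose f z := lower_gamma a1 z + lower_gamma a2 z - lower_gamma a z.
suff : f x <= f y.
  rewrite /f; move: (lower_gamma a1 x) (lower_gamma a2 x) (lower_gamma a x).
  by move: (lower_gamma a1 y) (lower_gamma a2 y) (lower_gamma a y) => *; lra.
apply: (@is_derive_ge0_le _ f (fun z => gamma_kernel (a1 - 1) z
  + gamma_kernel (a2 - 1) z - gamma_kernel (a - 1) z) _ _ xy) => z /andP[xz _].
  have z0 : 0 < z by exact: lt_le_trans xz.
  exact: is_deriveB (is_deriveD (is_derive_lower_gamma a10 z0)
    (is_derive_lower_gamma a20 z0)) (is_derive_lower_gamma a0 z0).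
by rewrite subr_ge0 gamma_kernel_le_endpoints// (lt_trans x0).
Qed.

(** Dominated convergence for shapes between a/2 and 2a, with the sum of the two endpoint kernels as
    majorant. A general [B] covers both [Gamma] and truncations at a fixed point. *)
Lemma continuous_integral_gamma_kernel (B : set R) a : measurable B ->
  B `<=` `]0, +oo[ -> 0 < a ->
  {for a, continuous (fun b : R => \int[mu]_(y in B) gamma_kernel (b - 1) y)}.
Proof.
move=> mB B0 a0.
have iB b : 0 < b -> mu.-integrable B (EFin \o gamma_kernel (b - 1)).
  by move=> b0; apply: integrableS (integrable_gamma_kernel b0).
have a20 : 0 < a / 2 by rewrite divr_gt0.
pose g y := gamma_kernel (a / 2 - 1) y + gamma_kernel (2 * a - 1) y.
apply: (@continuity_under_integral _ _ _ mu (fun b y => gamma_kernel (b - 1) y) B mB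
  (a / 2) (2 * a) _ _ g).
- by move=> b /=; rewrite in_itv/= => /andP[ab _]; apply: iB; exact: lt_trans ab.
- apply: aeW => y /B0/=; rewrite in_itv/= andbT => y0 b _.
  have -> : (fun b => gamma_kernel (b - 1) y) = (fun b => expR ((b - 1) * ln y - y)).
    by apply/funext => c; rewrite gamma_kernelE.
  apply: continuous_comp; last exact: continuous_expR.
  apply: continuousB; last exact: cst_continuous.
  apply: continuousM; last exact: cst_continuous.
  by apply: continuousB; [exact: id|exact: cst_continuous].
- have a2 : 0 < 2 * a by rewrite mulr_gt0.
  rewrite (_ : EFin \o g = (EFin \o gamma_kernel (a / 2 - 1)) \+
    (EFin \o gamma_kernel (2 * a - 1)))%E//.
  exact: (@integrableD _ _ _ mu B mB _ _ (iB _ a20) (iB _ a2)).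
- move=> b /=; rewrite in_itv/= => /andP[ab ba].
  apply: aeW => y /B0/=; rewrite in_itv/= andbT => y0.
  by rewrite ger0_norm ?gamma_kernel_ge0// gamma_kernel_le_endpoints// !ltW.
- by rewrite inE/= in_itv/=; lra.
Qed.

Lemma continuous_Gamma a : 0 < a -> {for a, continuous (@Gamma R)}.
Proof. by move=> a0; exact: continuous_integral_gamma_kernel. Qed.

(** Shape and upper limit move together. The change due to the limit is squeezed to 0 by the uniform
    modulus; what is left has the fixed limit [k * a]. *)
Lemma continuous_lower_gamma_mul k a : 0 < k -> 0 < a ->
  {for a, continuous (fun b => lower_gamma b (k * b))}.
Proof.
move=> k0 a0; have ka0 : 0 < k * a by rewrite mulr_gt0.
have a20 : 0 < a / 2 by rewrite divr_gt0.
have a2 : 0 < 2 * a by rewrite mulr_gt0.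
pose M x := lower_gamma (a / 2) x + lower_gamma (2 * a) x.
have cM : {for a, continuous (fun b => M (k * b))}.
  apply: (@continuous_comp _ _ _ (fun b => k * b) M).
    by apply: continuousM; [exact: cst_continuous|exact: id].
  by apply: continuousD; exact: continuous_lower_gamma.
have E0 : `|M (k * b) - M (k * a)| @[b --> a] --> (0 : R).
  rewrite -[X in _ --> X](@normr0 _ R) -(subrr (M (k * a))).
  by apply: cvg_norm; apply: cvgB; [exact: cM|exact: cvg_cst].
have D0 : lower_gamma b (k * b) - lower_gamma b (k * a) @[b --> a] --> (0 : R).
  apply: (@squeeze_cvgr _ _ _ _ (fun b => - `|M (k * b) - M (k * a)|)
    (fun b => `|M (k * b) - M (k * a)|)) => //; last first.
    by rewrite -[X in _ --> X]oppr0; exact: cvgN.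
  near=> b; rewrite -ler_norml; apply: lower_gamma_dist_le => //.
  - apply/andP; split; near: b.
      by apply: lt_le_nbhsr; lra.
    by apply: lt_le_nbhsl; lra.
  - by rewrite mulr_gt0//; near: b; exact: lt_nbhsr.
have cN : {for a, continuous (fun b => lower_gamma b (k * a))}.
  apply: continuous_integral_gamma_kernel => //.
  by move=> y /=; rewrite !in_itv/= andbT => /andP[].
have -> : (fun b => lower_gamma b (k * b)) = (fun b =>
    (lower_gamma b (k * b) - lower_gamma b (k * a)) + lower_gamma b (k * a)).
  by apply/funext => b; rewrite subrK.
by rewrite /prop_for/continuous_at/= subrr; exact: (cvgD D0 cN).
Unshelve. all: by end_near. Qed.

Lemma continuous_h k a : 0 < k -> 0 < a -> {for a, continuous (h k)}.
Proof.
move=> k0 a0.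
(* The quotient formula is available only for positive shapes, hence the equality merely near
   [a]. *)
have hk : \forall b \near a, lower_gamma b (k * b) / Gamma b = h k b.
  by near=> b; rewrite hE//; near: b; exact: lt_nbhsr.
rewrite /prop_for/continuous_at hE//; apply: cvg_trans (near_eq_cvg hk) _.
apply: cvgM; first exact: continuous_lower_gamma_mul.
by apply: cvgV; [rewrite gt_eqF ?Gamma_gt0|exact: continuous_Gamma].
Unshelve. all: by end_near. Qed.

(** * Attainment of the minimum *)

Lemma pos_min_attained (f : R -> R) lo hi : 0 < lo <= 1 -> 1 <= hi ->
  (forall a, 0 < a -> {for a, continuous f}) ->
  (forall a, 0 < a < lo -> f 1 <= f a) -> (forall a, hi < a -> f 1 <= f a) ->
  exists2 c, 0 < c & forall a, 0 < a -> f c <= f a.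
Proof.
move=> /andP[lo0 lo1] hi1 cf f_lo f_hi.
have [|c] := @EVT_min R f lo hi (le_trans lo1 hi1).
  apply: continuous_in_subspaceT => x /set_mem/=; rewrite in_itv/= => /andP[lox _].
  exact/cf/(lt_le_trans lo0).
rewrite in_itv/= => /andP[loc chi] cmin.
(* The point 1 lies in [lo, hi], so the minimum there is at most [f 1], which bounds [f] from below
   outside the interval. *)
have c1 : f c <= f 1 by apply: cmin; rewrite in_itv/= lo1.
exists c => [|a a0]; first exact: lt_le_trans loc.
have [alo|loa] := ltP a lo; first by rewrite (le_trans c1)// f_lo// a0.
have [ahi|hia] := leP a hi; first by apply: cmin; rewrite in_itv/= loa.
by rewrite (le_trans c1)// f_hi.
Qed.

Lemma h_ge_small k v : 1 < k -> v < 1 ->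
  exists2 lo, 0 < lo <= 1 & forall a, 0 < a < lo -> v <= h k a.
Proof.
move=> k1 v1; have k20 : 0 < 2 + k by lra.
(* Chosen so that the loss (2 + k) s is at most 1 - v; the threshold on [a] is then s^2, the
   estimate being used at the square root of [a]. *)
pose s := Num.min 1 ((1 - v) / (2 + k)).
have s0 : 0 < s by rewrite lt_min ltr01 divr_gt0// subr_gt0.
have s1 : s <= 1 by rewrite ge_min lexx.
have sv : (2 + k) * s <= 1 - v.
  by rewrite mulrC -ler_pdivlMr// ge_min lexx orbT.
exists (s ^+ 2) => [|a /andP[a0 as2]].
  by rewrite exprn_gt0// exprn_ile1// ltW.
have ts : Num.sqrt a <= s.
  by rewrite -[leRHS](ger0_norm (ltW s0)) -sqrtr_sqr ler_wsqrtr// ltW.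
have t01 : 0 < Num.sqrt a <= 1 by rewrite sqrtr_gt0 a0 (le_trans ts).
have := h_ge_near0 k1 t01; rewrite sqr_sqrtr ?(ltW a0)//; apply: le_trans.
have : (2 + k) * Num.sqrt a <= (2 + k) * s by rewrite ler_pM2l.
lra.
Qed.

Lemma h_ge_large k v : 1 < k -> v < 1 ->
  exists2 hi, 1 <= hi & forall a, hi < a -> v <= h k a.
Proof.
move=> k1 v1; have [d0 _] := h_ge_near_pinfty k1 (@ltr01 R).
set d := k - 1 - ln k in d0.
have v10 : 0 < 1 - v by rewrite subr_gt0.
(* The second argument solves 1 - 1/(d a) = v for [a]. *)
exists (Num.max 1 (d * (1 - v))^-1) => [|a]; first by rewrite le_max lexx.
rewrite gt_max => /andP[a1 da]; have a0 : 0 < a by exact: lt_trans a1.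
have [_] := h_ge_near_pinfty k1 a0; apply: le_trans; rewrite -/d.
move: da; rewrite lerBrDl -lerBrDr !invfM ltr_pdivrMr// => da.
by rewrite ler_pdivrMr// mulrC ltW.
Qed.

End gamma_cdf_at_multiple_of_mean.

Theorem mainTheorem5 (R : realType) (kappa : R) (hkappa : 1 < kappa) :
  exists alpha0 : R,
    [/\ 0 < alpha0,
        forall alpha : R, 0 < alpha -> h kappa alpha0 <= h kappa alpha
      & 1 / 2 < h kappa alpha0].
Proof.
have k0 : 0 < kappa by exact: lt_trans hkappa.
(* The value at 1 is the level that [h] must exceed near both ends, which is possible because it
   lies strictly below their common limit 1. *)
have h1 : h kappa 1 < 1 by exact: h_lt1.
have [lo lo01 h_lo] := h_ge_small hkappa h1.
have [hi hi1 h_hi] := h_ge_large hkappa h1.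
have [|c c0 hc] := pos_min_attained lo01 hi1 _ h_lo h_hi.
  by move=> a a0; exact: continuous_h.
by exists c; split; [exact: c0|exact: hc|exact: h_gt_half].
Qed.
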